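(* If $W$ is an even Coxeter group of finite rank, then every finite order element of $W$ is conjugacy distinguished in $W$.
   Context: A Coxeter group of finite rank is a group $W=\langle s_1,\dots,s_n \mid (s_is_j)^{m_{ij}}=1 \text{ for all } i,j\rangle$, where $(m_{ij})$ is a symmetric $n\times n$ matrix with $m_{ii}=1$ for all $i$ and $m_{ij}\in\{2,3,4,\dots\}\cup\{\infty\}$ for $i\ne j$ (if $m_{ij}=\infty$, no relation on $s_is_j$ is imposed). It is even if all off-diagonal $m_{ij}$ are even integers or $\infty$. An element $x$ of a group $G$ is conjugacy distinguished in $G$ if its conjugacy class $x^G$ is closed in the profinite topology on $G$; equivalently, for every $y\in G\setminus x^G$ there exist a finite group $F$ and a homomorphism $\alpha:G\to F$ such that $\alpha(y)$ is not conjugate to $\alpha(x)$ in $F$. *)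

(* Defs.v *)
From HB Require Import structures.
From mathcomp Require Import all_boot all_fingroup.
From mathcomp Require Import boolp classical_sets topology.
(* last, since fingroup also exports a repr *)
From mathcomp Require Import generic_quotient.

Set Implicit Arguments.
Unset Strict Implicit.
Unset Printing Implicit Defensive.

Local Open Scope quotient_scope.
Local Open Scope classical_set_scope.
Local Open Scope group_scope.

Notation group_hom := UMagmaMorphism.type.

(* Between groups, multiplicativity is enough. *)
Lemma hom1 (G H : groupType) (f : G -> H) :
  {morph f : x y / x * y} -> f 1 = 1.
Proof. by move=> fM; apply: (mulIg (f 1)); rewrite -fM !mul1g. Qed.

Definition Hom (G H : groupType) (f : G -> H) (fM : {morph f : x y / x * y}) :
    group_hom G H :=
  HB.pack f (isUMagmaMorphism.Build G H f (hom1 fM, fM)).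

Lemma HomE (G H : groupType) (f : G -> H) (fM : {morph f : x y / x * y}) :
  Hom fM =1 f.
Proof. by []. Qed.

(** * Groups given by generators and relations *)

Section Presentation.
Variable I : choiceType.

(* The letter (i, false) stands for the generator i, and (i, true) for its
   formal inverse. *)
Definition word := seq (I * bool).

Definition inv_letter (a : I * bool) : I * bool := (a.1, ~~ a.2).

Definition inv_word (w : word) : word := rev (map inv_letter w).

(* The congruence on words whose quotient is the free group on I modulo the
   normal closure of the relators R. *)
Inductive pres_eq (R : set word) : word -> word -> Prop :=
| pres_refl u : pres_eq R u u
| pres_sym u v : pres_eq R u v -> pres_eq R v u
| pres_trans v u w : pres_eq R u v -> pres_eq R v w -> pres_eq R u w
| pres_cat u u' v v' :
    pres_eq R u u' -> pres_eq R v v' -> pres_eq R (u ++ v) (u' ++ v')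
| pres_cancel a : pres_eq R [:: a; inv_letter a] [::]
| pres_relator r : R r -> pres_eq R r [::].

Variable R : set word.

Definition pres_eqb (u v : word) : bool := `[< pres_eq R u v >].

Lemma pres_eqb_equiv : equiv_class_of pres_eqb.
Proof.
split=> [u|u v|v u w]; first by apply/asboolP; apply: pres_refl.
  by apply/asboolP/asboolP; apply: pres_sym.
by move=> /asboolP uv /asboolP vw; apply/asboolP; apply: pres_trans uv vw.
Qed.

Canonical pres_equiv := EquivRelPack pres_eqb_equiv.

Definition presented_group := {eq_quot pres_equiv}.

HB.instance Definition _ := Choice.on presented_group.
HB.instance Definition _ := EqQuotient.on presented_group.

Lemma presP (u v : word) :
  (\pi u = \pi v :> presented_group) <-> pres_eq R u v.
Proof. by split=> [/eqmodP/asboolP|uv]; last by apply/eqmodP/asboolP. Qed.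

Lemma pres_reprK (u : word) : pres_eq R (repr (\pi u : presented_group)) u.
Proof. by apply/presP; rewrite reprK. Qed.

Lemma inv_letterK : involutive inv_letter.
Proof. by case=> i b; rewrite /inv_letter /= negbK. Qed.

Lemma inv_wordK : involutive inv_word.
Proof.
by move=> w; rewrite /inv_word map_rev revK -map_comp map_id_in // => a _ /=;
  rewrite inv_letterK.
Qed.

Lemma pres_catV (w : word) : pres_eq R (w ++ inv_word w) [::].
Proof.
elim: w => [|a w IHw]; first exact: pres_refl.
have -> : inv_word (a :: w) = inv_word w ++ [:: inv_letter a].
  by rewrite /inv_word map_cons rev_cons cats1.
have -> : (a :: w) ++ inv_word w ++ [:: inv_letter a] =
    [:: a] ++ (w ++ inv_word w) ++ [:: inv_letter a] by rewrite /= catA.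
apply: pres_trans (pres_cancel R a).
apply: (pres_cat (u' := [:: a]) (v' := [:: inv_letter a])).
  exact: pres_refl.
by rewrite -[X in pres_eq R _ X]cat0s; apply: pres_cat IHw (pres_refl R _).
Qed.

Lemma pres_catVl (w : word) : pres_eq R (inv_word w ++ w) [::].
Proof. by rewrite -{2}[w]inv_wordK; apply: pres_catV. Qed.

Definition pres_mul (x y : presented_group) : presented_group :=
  \pi_presented_group (repr x ++ repr y).
Definition pres_one : presented_group := \pi_presented_group [::].
Definition pres_inv (x : presented_group) : presented_group :=
  \pi_presented_group (inv_word (repr x)).

Lemma pres_mulA : associative pres_mul.
Proof.
move=> x y z; apply/presP.
apply: (@pres_trans _ (repr x ++ (repr y ++ repr z))).
  by apply: pres_cat (pres_refl R _) (pres_reprK _).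
by rewrite catA; apply: pres_cat (pres_sym (pres_reprK _)) (pres_refl R _).
Qed.

Lemma pres_mul1 : left_id pres_one pres_mul.
Proof.
move=> x; rewrite -[RHS]reprK; apply/presP.
by rewrite -[X in pres_eq R _ X]cat0s; apply: pres_cat (pres_reprK _) (pres_refl R _).
Qed.

Lemma pres_mulr1 : right_id pres_one pres_mul.
Proof.
move=> x; rewrite -[RHS]reprK; apply/presP.
by rewrite -[X in pres_eq R _ X]cats0; apply: pres_cat (pres_refl R _) (pres_reprK _).
Qed.

Lemma pres_mulV : left_inverse pres_one pres_inv pres_mul.
Proof.
move=> x; apply/presP; apply: pres_trans (pres_catVl (repr x)).
exact: pres_cat (pres_reprK _) (pres_refl R _).
Qed.

Lemma pres_mulrV : right_inverse pres_one pres_inv pres_mul.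
Proof.
move=> x; apply/presP; apply: pres_trans (pres_catV (repr x)).
exact: pres_cat (pres_refl R _) (pres_reprK _).
Qed.

HB.instance Definition _ := isGroup.Build presented_group
  pres_mulA pres_mul1 pres_mulr1 pres_mulV pres_mulrV.

End Presentation.

(** * Coxeter groups *)

(* None encodes an infinite entry. *)
Definition coxeter_matrix (n : nat) (m : 'I_n -> 'I_n -> option nat) : Prop :=
  [/\ forall i j, m i j = m j i,
      forall i, m i i = Some 1%N &
      forall i j k, i != j -> m i j = Some k -> (2 <= k)%N].

Definition even_matrix (n : nat) (m : 'I_n -> 'I_n -> option nat) : Prop :=
  forall i j k, i != j -> m i j = Some k -> ~~ odd k.

(* The words (s_i s_j)^k with k = m_ij finite. *)
Definition coxeter_relators (n : nat) (m : 'I_n -> 'I_n -> option nat) :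
    set (word 'I_n) :=
  [set r | exists i j k, m i j = Some k /\
     r = flatten (nseq k [:: (i, false); (j, false)])].

Definition coxeter_group (n : nat) (m : 'I_n -> 'I_n -> option nat) :=
  presented_group (coxeter_relators m).

HB.instance Definition _ n (m : 'I_n -> 'I_n -> option nat) :=
  Group.on (coxeter_group m).

Definition isomorphic (G H : groupType) : Prop :=
  exists f : group_hom G H, bijective f.

Definition even_coxeter_group (W : groupType) : Prop :=
  exists n (m : 'I_n -> 'I_n -> option nat),
    [/\ coxeter_matrix m, even_matrix m & isomorphic W (coxeter_group m)].

(** * The profinite topology *)

Definition profinite (G : groupType) : Type := G.

Section Profinite.
Variable G : groupType.

HB.instance Definition _ := Choice.on (profinite G).

(* Unions of fibres of homomorphisms to finite groups, i.e. unions of cosets of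
   normal subgroups of finite index. *)
Definition profinite_open : set_system (profinite G) :=
  [set A | forall y : G, A y ->
     exists (F : finGroupType) (f : group_hom G F),
       f @^-1` [set f y] `<=` A].

Lemma profinite_openT : profinite_open setT.
Proof.
pose triv (_ : G) : {perm 'I_1} := 1.
have trivM : {morph triv : x y / x * y} by move=> x y; rewrite /triv mulg1.
by move=> y _; exists {perm 'I_1}, (Hom trivM).
Qed.

Lemma profinite_openI : setI_closed profinite_open.
Proof.
move=> A B oA oB y [/oA [F1 [f1 s1]] /oB [F2 [f2 s2]]].
pose h (x : G) : F1 * F2 := (f1 x, f2 x).
have hM : {morph h : x y / x * y} by move=> x z; rewrite /h !gmulfM.
exists (F1 * F2)%type, (Hom hM) => z /= [e1 e2].
by split; [apply: s1 | apply: s2].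
Qed.

Lemma profinite_open_bigU (J : Type) (A : J -> set (profinite G)) :
  (forall i, profinite_open (A i)) -> profinite_open (\bigcup_i A i).
Proof.
move=> oA y [i _ /oA [F [f sf]]]; exists F, f => z fz.
by exists i => //; apply: sf.
Qed.

HB.instance Definition _ := isOpenTopological.Build (profinite G)
  profinite_openT profinite_openI profinite_open_bigU.

Lemma profinite_openE (A : set (profinite G)) : open A = profinite_open A.
Proof. by []. Qed.

End Profinite.

Definition conj_class (G : groupType) (x : G) : set G := range (conjg x).

Definition conjugacy_distinguished (G : groupType) (x : G) : Prop :=
  closed (conj_class x : set (profinite G)).

Definition finite_order (G : groupType) (x : G) : Prop :=
  exists2 k : nat, (0 < k)%N & x ^+ k = 1.

Lemma conjugacy_distinguishedP (G : groupType) (x : G) :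
  conjugacy_distinguished x <->
  forall y : G, ~ conj_class x y ->
    exists (F : finGroupType) (f : group_hom G F),
      ~ exists g : F, f y = f x ^ g.
Proof.
rewrite /conjugacy_distinguished -openC profinite_openE.
split=> [oxG y nxy | sep y nxy].
  have [F [f sf]] := oxG y nxy.
  pose im := [set z : F | `[< exists g, f g = z >]]%SET.
  have imP z : reflect (exists g, f g = z) (z \in im).
    by rewrite inE; apply: asboolP.
  have im_group : group_set im.
    apply/group_setP; split=> [|z1 z2]; first by apply/imP; exists 1; rewrite gmulf1.
    case/imP=> a az; case/imP=> b bz.
    by apply/imP; exists (a * b); rewrite gmulfM az bz.
  pose H := Group im_group.
  have fH a : f a \in H by apply/imP; exists a.
  pose h (a : G) : subg_of H := subg H (f a).
  have hM : {morph h : a b / a * b}.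
    by move=> a b; rewrite /h gmulfM morphM ?fH.
  exists (subg_of H), (Hom hM) => -[c /(congr1 val)].
  rewrite /conjg /= /h !subgK // => fy.
  case/imP: (subgP c) => g fg.
  have /sf nx : f (x ^ g) = f y by rewrite gmulfJ fg conjgE -fy.
  by apply: nx; exists g.
have [F [f nf]] := sep y nxy.
exists F, f => z /= fz [g _ xg]; apply: nf; exists (f g).
by rewrite -fz -xg gmulfJ.
Qed.

(* Main.v *)
Require Import Defs.
From HB Require Import structures.
From mathcomp Require Import all_boot all_order all_algebra all_fingroup.
From mathcomp Require Import boolp classical_sets topology.
From mathcomp Require Import generic_quotient.
From mathcomp Require Import reals Rstruct trigo.
From mathcomp Require Import zify ring.
Import Order.TTheory GRing.Theory Num.Theory.

Set Implicit Arguments.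
Unset Strict Implicit.
Unset Printing Implicit Defensive.

Local Open Scope group_scope.

(** Let x have finite order in an even Coxeter group W, and suppose that y
    cannot be separated from the class of x: in every finite quotient, y has
    the same image as some conjugate of x.  The claim is that y is conjugate
    to x.  Three facts about W give this.

    - W is residually finite ([residually_finite]).  Hence y has finite order:
      if x^k = 1 but y^k <> 1, a finite quotient that detects y^k separates y
      from the conjugates of x.
    - Every element of finite order is conjugate into a finite standard
      parabolic subgroup W_J ([finite_order_parabolic]).
    - Since W is even, sending the generators outside J to 1 respects the
      relations, so W retracts onto W_J ([retraction]).  When W_J is finite,
      residual finiteness and inseparability make the images of x and y under
      this retraction conjugate ([conjugate_short_image]).

    Now replace x and y by conjugates x' in W_I and y' in W_J, with W_I and
    W_J finite, and let r_I, r_J be the retractions.  Then x' = r_I(x') is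
    conjugate to r_I(y'), and y' = r_J(y') is conjugate to r_J(x').  Retractions
    commute, so r_I(y') is fixed by r_J; applying r_J to the first relation
    makes r_J(x') conjugate to r_I(y'), and y is conjugate to x.

    The first two facts come from reflection representations, in which the
    coefficient of a generator i in a vector is an element of an ordered
    abelian group M instead of a number, and the off-diagonal entries of the
    Cartan matrix are endomorphisms N_ij = N_ji of M, a group without
    2-torsion.  The essential requirement is that the Chebyshev recursion
    U_0 = 0, U_1 = x, U_(k+2) = N_ij U_(k+1) - U_k vanishes at k = m_ij for all
    x and stays nonnegative up to there for x nonnegative.  This implies both
    the Coxeter relations ([refl_rel]) and the theorem of Tits that w sends
    the simple root i to a nonnegative vector whenever w s_i is not shorter
    than w ([tits_pos]); faithfulness follows.

    For residual finiteness M is a power of the integers and N_ij is the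
    adjacency operator of disjoint paths with m_ij - 1 vertices (Dynkin
    diagrams of type A, whose Coxeter number is m_ij).  So W acts faithfully on
    a free abelian group of finite rank, and reduction modulo integers q gives
    enough finite quotients.

    For elements of finite order M is the real line and
    N_ij = 2 cos(pi / m_ij).  The sum of the functionals height o x^i, for i
    below the order of x, is invariant under x.  Reflecting in simple roots on
    which it is negative reaches a translate that is nonnegative on all simple
    roots; the stabiliser of such a functional is generated by the reflections
    in the simple roots on which it vanishes.  Termination of the descent and
    finiteness of the stabiliser are one length estimate ([chain_bound]). *)

(** * Words and actions of a Coxeter group *)

Section Coxeter.
Variables (n : nat) (m : 'I_n -> 'I_n -> option nat).
Let W := coxeter_group m.

Definition eval (u : word 'I_n) : W :=
  \pi_(presented_group (coxeter_relators m))%qT u.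

Lemma eval_repr (w : W) : eval (repr (w : presented_group _))%qT = w.
Proof. exact: reprK. Qed.

Definition gen (i : 'I_n) : W := eval [:: (i, false)].

Definition prodw (l : seq 'I_n) : W := foldr (fun i g => gen i * g) 1 l.

Lemma prodw_cat l1 l2 : prodw (l1 ++ l2) = prodw l1 * prodw l2.
Proof. by elim: l1 => [|i l IH] /=; rewrite ?mul1g // IH mulgA. Qed.

Lemma eval_cat u v : eval (u ++ v) = eval u * eval v.
Proof.
apply/presP; apply: pres_sym; apply: pres_cat; exact: pres_reprK.
Qed.

Lemma gen_relator i j k : m i j = Some k -> (gen i * gen j) ^+ k = 1.
Proof.
move=> mij.
suff -> : (gen i * gen j) ^+ k = eval
    (flatten (nseq k [:: (i, false); (j, false)])).
  by apply/presP; apply: pres_relator; exists i, j, k.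
elim: k {mij} => [|k IH]; first by rewrite expg0.
rewrite expgS IH /= -/([:: (i, false)] ++ [:: (j, false)] ++ flatten _).
by rewrite !eval_cat mulgA.
Qed.

Hypothesis mP : coxeter_matrix m.

Lemma gen_sq i : gen i * gen i = 1.
Proof. by case: mP => _ mii _; rewrite -(gen_relator (mii i)) expg1. Qed.

Lemma gen_inv i : (gen i)^-1 = gen i.
Proof. exact: mulg1_eq (gen_sq i). Qed.

Lemma mulgenK i (w : W) : w * gen i * gen i = w.
Proof. by rewrite -mulgA gen_sq mulg1. Qed.

Lemma prodw_rev l : prodw (rev l) = (prodw l)^-1.
Proof.
elim: l => [|i l IH]; first by rewrite invg1.
by rewrite rev_cons -cats1 prodw_cat IH /= invgM mulg1 gen_inv.
Qed.

Lemma prodw_rcons l i : prodw (rcons l i) = prodw l * gen i.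
Proof. by rewrite -cats1 prodw_cat /= mulg1. Qed.

Lemma eval_letter (a : 'I_n * bool) : eval [:: a] = gen a.1.
Proof.
case: a => i [] //=; apply/eqP; rewrite -[X in _ == X]gen_inv -mulg_eq1.
rewrite -[_ * _]eval_cat /=; apply/eqP/presP.
exact: (pres_cancel _ (i, true)).
Qed.

Lemma eval_prodw (u : word 'I_n) : eval u = prodw (map fst u).
Proof.
elim: u => [|a u IH]; first by [].
by rewrite -cat1s eval_cat IH eval_letter.
Qed.

Lemma prodw_surj (w : W) : exists l, w = prodw l.
Proof.
exists (map fst (repr (w : presented_group _))%qT).
by rewrite -eval_prodw eval_repr.
Qed.

(** Infinite representations, finite quotients and left translations are all
    obtained from the same criterion: a family of maps of a set satisfying the
    Coxeter relations extends to an action of the group. *)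
Section Action.
Variables (X : Type) (s : 'I_n -> X -> X).

Definition actl (l : seq 'I_n) (x : X) : X := foldr s x l.
(** Formal inverses in a word are read as the letters themselves, because the
    maps s i will be involutions. *)
Definition cact (w : W) : X -> X :=
  actl (map fst (repr (w : presented_group _))%qT).

Lemma actl_cat l1 l2 x : actl (l1 ++ l2) x = actl l1 (actl l2 x).
Proof. exact: foldr_cat. Qed.

Hypothesis s_rel : forall i j k, m i j = Some k ->
  forall x, iter k (s i \o s j) x = x.

Lemma s_invol i : involutive (s i).
Proof. by case: mP => _ mii _ x; apply: (s_rel (mii i)). Qed.

Lemma actl_pres u v : pres_eq (coxeter_relators m) u v ->
  actl (map fst u) =1 actl (map fst v).
Proof.
elim=> {u v} [u|u v _ IH|v u w _ IH1 _ IH2|u u' v v' _ IH1 _ IH2|a|r rr] x //.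
- by rewrite IH1.
- by rewrite !map_cat !actl_cat IH2 IH1.
- by rewrite /= s_invol.
case: rr => i [j [k [mij ->]]]; rewrite -[RHS](s_rel mij).
by elim: k {mij} => //= k <-.
Qed.

Lemma cact_prodw l : cact (prodw l) =1 actl l.
Proof.
move=> x; have := @actl_pres _ (map (fun i => (i, false)) l) (pres_reprK _ _) x.
rewrite -map_comp map_id => <-.
by rewrite /cact -/(eval _) eval_prodw -map_comp map_id.
Qed.

Lemma cact1 : cact 1 =1 id.
Proof. exact: (cact_prodw [::]). Qed.

Lemma cact_gen i : cact (gen i) =1 s i.
Proof. by move=> x; rewrite -[gen i]mulg1 (cact_prodw [:: i]). Qed.

Lemma cactM u v x : cact (u * v) x = cact u (cact v x).
Proof.
have [l ->] := prodw_surj u; have [l' ->] := prodw_surj v.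
by rewrite -prodw_cat !cact_prodw actl_cat.
Qed.

Lemma cactK w : cancel (cact w) (cact w^-1).
Proof. by move=> x; rewrite -cactM mulVg cact1. Qed.

End Action.

(** The action of W on G through left translations by the g i commutes with
    right translations, so evaluating it at 1 is a morphism. *)
Lemma coxeter_lift (G : groupType) (g : 'I_n -> G) :
  (forall i j k, m i j = Some k -> (g i * g j) ^+ k = 1) ->
  exists f : group_hom W G, forall i, f (gen i) = g i.
Proof.
move=> g_rel; pose s i (x : G) := g i * x.
have s_rel i j k : m i j = Some k -> forall x, iter k (s i \o s j) x = x.
  move=> mij x; rewrite -[RHS]mul1g -(g_rel _ _ _ mij) -iter_mulg.
  by apply: eq_iter => y; rewrite /s /= mulgA.
have cact_mulg w x y : cact s w (x * y) = cact s w x * y.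
  have [l ->] := prodw_surj w; rewrite !(cact_prodw s_rel).
  by elim: l => //= i l ->; rewrite /s mulgA.
have fM : {morph (fun w => cact s w 1) : x y / x * y}.
  by move=> u v /=; rewrite (cactM s_rel) -cact_mulg mul1g.
by exists (Defs.Hom fM) => i; rewrite HomE (cact_gen s_rel) /s mulg1.
Qed.

(** * The length function *)

Lemma len_ex (w : W) : exists k, `[< exists2 l, size l = k & w = prodw l >].
Proof.
by have [l ->] := prodw_surj w; exists (size l); apply/asboolP; exists l.
Qed.

Definition len (w : W) : nat := ex_minn (len_ex w).
Arguments len w%_g.

Lemma len_word w : exists2 l, size l = len w & w = prodw l.
Proof. by rewrite /len; case: ex_minnP => k /asboolP. Qed.

Lemma len_le l : (len (prodw l) <= size l)%N.
Proof.
by rewrite /len; case: ex_minnP => k _; apply; apply/asboolP; exists l.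
Qed.

Lemma len1 : len 1 = 0%N.
Proof. by apply/eqP; rewrite -leqn0; exact: (len_le [::]). Qed.

Lemma lenM (u v : W) : (len (u * v) <= len u + len v)%N.
Proof.
have [l <- ->] := len_word u; have [l' <- ->] := len_word v.
by rewrite -prodw_cat -size_cat len_le.
Qed.

Lemma lenV (u : W) : len u^-1 = len u.
Proof.
suff H (v : W) : (len v^-1 <= len v)%N.
  by apply/eqP; rewrite eqn_leq H -{1}[u]invgK H.
by have [l <- ->] := len_word v; rewrite -prodw_rev -(size_rev l) len_le.
Qed.

Lemma len_gen i : (len (gen i) <= 1)%N.
Proof. by have := len_le [:: i]; rewrite /= mulg1. Qed.

Lemma len_mulgen (w : W) i : (len (w * gen i) <= (len w).+1)%N.
Proof. by rewrite -addn1 (leq_trans (lenM _ _)) // leq_add2l len_gen. Qed.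

(** Removing the last letter of a shortest word; this drives every induction
    on the length. *)
Lemma len_descent (w : W) : w <> 1 -> exists i, (len (w * gen i) < len w)%N.
Proof.
have [l] := len_word w; case/lastP: l => [|l i] lw wl // _.
by exists i; rewrite -lw size_rcons ltnS wl prodw_rcons mulgenK len_le.
Qed.

(** * Alternating words *)

(** The recursion peels off the rightmost letter, because this is the letter
    that acts first on a vector. *)
Fixpoint alt (i j : 'I_n) (k : nat) : W :=
  if k is k'.+1 then alt j i k' * gen j else 1.

Lemma alt_left i j k :
  alt i j k.+1 = gen (if odd k then i else j) * alt i j k.
Proof.
elim: k i j => [|k IH] i j; first by rewrite /= mul1g mulg1.
by rewrite -[LHS]/(alt j i k.+1 * gen j) IH -mulgA /=; case: (odd k).
Qed.

Lemma alt_split i j a b :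
  exists i' j', alt i j (a + b) = alt i' j' a * alt i j b.
Proof.
elim: b i j => [|b IH] i j; first by exists i, j; rewrite addn0 mulg1.
have [i' [j' e]] := IH j i; exists i', j'.
by rewrite addnS /= e mulgA.
Qed.

Lemma alt_len i j k : (len (alt i j k) <= k)%N.
Proof.
elim: k i j => [|k IH] i j /=; first by rewrite len1.
by rewrite (leq_trans (len_mulgen _ _)) // ltnS.
Qed.

Lemma alt_double i j k : alt i j k.*2 = (gen i * gen j) ^+ k.
Proof. by elim: k => //= k ->; rewrite expgSr mulgA. Qed.

(** Of the 2k letters of the relator, k + 1 can be traded for the inverse of
    the other k - 1. *)
Lemma alt_succ_len i j k : m i j = Some k -> (len (alt i j k.+1) <= k.-1)%N.
Proof.
move=> mij; case: k mij => [|k] mij; last first.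
  have [i' [j' e]] := alt_split i j k k.+2.
  have: alt i j (k + k.+2) = 1.
    by rewrite -(gen_relator mij) -alt_double -addnn !addnS.
  rewrite e => /eqP; rewrite mulg_eq1 => /eqP /(congr1 invg).
  rewrite invgK => <-.
  by rewrite lenV alt_len.
case: mP => _ mii H; have [ij|/H /(_ mij) //] := eqVneq i j.
by move: mij; rewrite ij mii.
Qed.

End Coxeter.

Arguments len {n m} mP w%_g.

(** * The Chebyshev recursion of an endomorphism *)

(** Products of two reflections in the plane of two simple roots are governed
    by the sequence b, a, f a - b, ..., in which f stands for twice the cosine
    of the angle.  Starting from 0, x it is sin(k t) / sin(t) applied to x. *)

Section Cheb.
Local Open Scope ring_scope.
Variables (M : zmodType) (f : {additive M -> M}).

Fixpoint cheb (b a : M) (k : nat) : M :=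
  if k is k'.+1 then cheb a (f a - b) k' else b.

Lemma chebS b a k : cheb b a k.+1 = cheb a (f a - b) k.
Proof. by []. Qed.

Lemma chebSS b a k : cheb b a k.+2 = f (cheb b a k.+1) - cheb b a k.
Proof. by elim: k b a => [//|k IH] b a; apply: IH. Qed.

Lemma chebD b a b' a' k : cheb (b + b') (a + a') k = cheb b a k + cheb b' a' k.
Proof.
elim: k b a b' a' => //= k IH b a b' a'; rewrite -IH raddfD.
by congr cheb; rewrite opprD addrACA.
Qed.

Lemma chebN b a k : cheb (- b) (- a) k = - cheb b a k.
Proof.
elim: k b a => //= k IH b a; rewrite -IH raddfN.
by congr cheb; rewrite opprB opprK addrC.
Qed.

Lemma cheb_shift b a k l :
  cheb b a (k + l) = cheb (cheb b a k) (cheb b a k.+1) l.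
Proof. by elim: k b a => [//|k IH] b a; rewrite addSn /= IH. Qed.

Arguments cheb : simpl never.

Variable k : nat.
Hypothesis cheb0 : forall x, cheb 0 x k.+1 = 0.

(** The sequence satisfies a recursion symmetric under reversal, and it
    vanishes at both ends 0 and k + 1: read backwards it is the sequence
    started from its k-th term. *)
Lemma cheb_rev x l : (l <= k)%N ->
  cheb 0 (cheb 0 x k) l = cheb 0 x (k.+1 - l) /\
  cheb 0 (cheb 0 x k) l.+1 = cheb 0 x (k - l).
Proof.
elim: l => [|l IH] lk; first by rewrite !subn0 cheb0.
have [IH1 IH2] := IH (ltnW lk); rewrite subSS IH2; split=> //.
rewrite chebSS IH1 IH2.
have -> : (k.+1 - l = (k - l.+1).+2)%N by lia.
have -> : (k - l = (k - l.+1).+1)%N by lia.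
by rewrite chebSS opprB addrCA subrr addr0.
Qed.

Lemma cheb_double x : cheb 0 x k.+1.*2 = 0 /\ cheb 0 x k.+1.*2.+1 = x.
Proof.
have S y : cheb 0 y k.+2 = - cheb 0 y k by rewrite chebSS cheb0 raddf0 sub0r.
rewrite -addnn -addnS !cheb_shift cheb0; split; first exact: cheb0.
rewrite !S -[in X in - cheb X _ _]oppr0 chebN opprK.
by have [-> _] := cheb_rev x (leqnn k); rewrite subSnn.
Qed.

(** The analogue of the periodicity of sin(j pi / (k + 1)) in j, for every
    pair of initial values. *)
Lemma cheb_period b a : cheb b a k.+1.*2 = b /\ cheb b a k.+1.*2.+1 = a.
Proof.
have [e1 e2] := cheb_double a; have [e3 e4] := cheb_double (- b).
have bS l : cheb b 0 l.+1 = cheb 0 (- b) l by rewrite chebS raddf0 sub0r.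
have eD l : cheb b a l = cheb b 0 l + cheb 0 a l by rewrite -chebD addr0 add0r.
rewrite !eD e1 e2 bS e3 add0r addr0; split=> //.
have := chebSS 0 (- b) k.*2.+1.
rewrite -!doubleS e3 raddf0 sub0r e4 => /oppr_inj.
by rewrite bS => <-.
Qed.

End Cheb.

(** * The reflection representation *)

(** The vector v stands for the combination of the simple roots i with
    coefficients v i in M. *)

Section Reflections.
Local Open Scope ring_scope.
Variables (n : nat) (m : 'I_n -> 'I_n -> option nat) (mP : coxeter_matrix m).
Variables (M : zmodType) (N : 'I_n -> 'I_n -> {additive M -> M}).

Let V := {ffun 'I_n -> M}.
Implicit Types v w : V.

Definition refl (i : 'I_n) (v : V) : V :=
  [ffun j => if j == i then - v i + \sum_(l | l != i) N i l (v l) else v j].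

Definition single (i : 'I_n) (a : M) : V := [ffun j => if j == i then a else 0].

Lemma single0 i : single i 0 = 0.
Proof. by apply/ffunP => j; rewrite !ffunE if_same. Qed.

Lemma ffun_single v : v = \sum_i single i (v i).
Proof.
apply/ffunP => j; rewrite sum_ffunE (bigD1 j) //= big1.
  by rewrite ffunE eqxx addr0.
by move=> i ij; rewrite ffunE eq_sym (negPf ij).
Qed.

Lemma ffun_subE v w i : (v - w) i = v i - w i.
Proof. by rewrite !ffunE. Qed.

Lemma reflD i v w : refl i (v + w) = refl i v + refl i w.
Proof.
apply/ffunP => j; rewrite !ffunE; case: ifP => // _.
rewrite opprD addrACA; congr (_ + _); rewrite -big_split /=.
by apply: eq_bigr => l _; rewrite ffunE raddfD.
Qed.

Lemma refl_invol i : involutive (refl i).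
Proof.
move=> v; apply/ffunP => j; rewrite ffunE.
case: eqP => [->|/eqP ji]; last first.
  by rewrite ffunE (negPf ji).
rewrite ffunE eqxx opprD opprK -addrA.
rewrite [X in _ + X](_ : _ = 0) ?addr0 //.
apply/eqP; rewrite addrC subr_eq0; apply/eqP/eq_bigr => l li.
by rewrite ffunE (negPf li).
Qed.

Lemma refl_single i a : refl i (single i a) = - single i a.
Proof.
apply/ffunP => j; rewrite !ffunE eqxx; case: (j == i); last by rewrite oppr0.
by rewrite big1 ?addr0 // => l /negPf li; rewrite ffunE li raddf0.
Qed.

Definition plane_vec (i j : 'I_n) a b := single i a + single j b.

Lemma refl_plane_vec i j a b : i != j ->
  refl j (plane_vec i j a b) = plane_vec i j a (N j i a - b).
Proof.
move=> ij; apply/ffunP => l; rewrite !ffunE; case: eqP => [->|/eqP lj] //=.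
rewrite [j == i]eq_sym (negPf ij) !eqxx !add0r addrC; congr (_ - _).
rewrite (bigD1 i) //= !ffunE eqxx (negPf ij) addr0 big1 ?addr0 //.
by move=> p /andP [/negPf pj /negPf pi]; rewrite !ffunE pi pj addr0 raddf0.
Qed.

Lemma plane_vecC i j a b : plane_vec i j a b = plane_vec j i b a.
Proof. by rewrite /plane_vec addrC. Qed.

Hypothesis Nsym : forall i j, i != j -> N i j =1 N j i.
Hypothesis tor2 : forall x : M, x *+ 2 = 0 -> x = 0.
Hypothesis cheb_m : forall i j k, i != j -> m i j = Some k ->
  forall x, cheb (N i j) 0 x k = 0.

Section Plane.
Variables (i j : 'I_n) (k : nat).
Hypotheses (ij : i != j) (mij : m i j = Some k.+1).

Let F (p : nat) := iter p (refl i \o refl j).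

Lemma rotation_plane p a b :
  F p (plane_vec i j a b) =
  plane_vec i j (cheb (N i j) b a p.*2.+1) (cheb (N i j) b a p.*2).
Proof.
elim: p => [|p IH]; first by [].
rewrite /F iterS -/(F p) IH /= refl_plane_vec // plane_vecC.
rewrite refl_plane_vec 1?eq_sym // plane_vecC.
by rewrite -(Nsym ij) -!chebSS.
Qed.

Lemma rotation_plane_order a b : F k.+1 (plane_vec i j a b) = plane_vec i j a b.
Proof.
by rewrite rotation_plane; have [-> ->] := cheb_period (cheb_m ij mij) b a.
Qed.

Lemma rotationD p v w : F p (v + w) = F p v + F p w.
Proof. by elim: p => //= p ->; rewrite !reflD. Qed.

Definition inplane (v : V) := v = plane_vec i j (v i) (v j).

Lemma inplaneP (v : V) : (forall l, l != i -> l != j -> v l = 0) -> inplane v.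
Proof.
move=> v0; apply/ffunP => l; rewrite !ffunE.
case: eqP => [->|/eqP li]; first by rewrite (negPf ij) addr0.
by case: eqP => [->|/eqP lj]; rewrite add0r // v0.
Qed.

Lemma rotation_off p v l : l != i -> l != j -> F p v l = v l.
Proof.
by move=> li lj; elim: p => //= p IH; rewrite !ffunE (negPf li) (negPf lj).
Qed.

Lemma rotation_inv p v : iter p (refl j \o refl i) (F p v) = v.
Proof.
elim: p v => // p IH v.
by rewrite iterSr /F iterS /= !refl_invol -/(F p v) IH.
Qed.

Lemma rotation_conj l p v : l = i \/ l = j ->
  refl l (F p v) = iter p (refl j \o refl i) (refl l v).
Proof.
case=> ->; elim: p v => // p IH v.
  by rewrite iterS -IH /F iterS /= !refl_invol.
by rewrite iterSr /F iterSr IH.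
Qed.

Lemma refl_disp l v : (forall p, p != l -> refl l v p = v p).
Proof. by move=> p /negPf pl; rewrite ffunE pl. Qed.

(** The rotation F fixes the plane of the two roots by periodicity of the
    recursion, and it moves every vector by an element B of that plane.  Since
    conjugation by either reflection inverts the rotation, both reflections
    map B to - B; comparing the coefficient that each reflection leaves alone
    gives 2 B = 0. *)
Lemma rotation_order v : F k.+1 v = v.
Proof.
set B := F k.+1 v - v.
have Bv : F k.+1 v = v + B by rewrite /B addrC subrK.
have fix_plane w : inplane w -> F k.+1 w = w.
  by move=> ->; rewrite rotation_plane_order.
have Bpl : inplane B.
  apply: inplaneP => l li lj.
  by rewrite ffun_subE rotation_off // subrr.
have BE l : l = i \/ l = j -> refl l B = - B.
  move=> lij.
  (* Expand s_l F s_l F v = v, where F fixes everything in the plane. *)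
  have plane_disp w : inplane (refl l w - w).
    apply: inplaneP => p pi pj; rewrite ffun_subE refl_disp ?subrr //.
    by case: lij => ->.
  have reflB : inplane (refl l B).
    apply: inplaneP => p pi pj; rewrite refl_disp; last by case: lij => ->.
    by rewrite ffun_subE rotation_off // subrr.
  have: refl l (F k.+1 (refl l (F k.+1 v))) = v.
    by rewrite rotation_conj // refl_invol rotation_inv.
  rewrite Bv reflD rotationD (fix_plane _ reflB).
  rewrite -[refl l v](subrK v) rotationD fix_plane // Bv.
  rewrite addrA subrK !reflD !refl_invol => e.
  by apply/eqP; rewrite -addr_eq0; apply/eqP/(addrI v); rewrite addr0 addrA e.
have twoB p : B p = - B p -> B p = 0.
  by move=> e; apply: tor2; rewrite mulr2n {1}e addNr.
have Bi : B i = 0.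
  by apply: twoB; rewrite -{1}(@refl_disp j B i) // BE; [rewrite ffunE|right].
have Bj : B j = 0.
  by apply: twoB; rewrite -{1}(@refl_disp i B j) 1?eq_sym // BE;
     [rewrite ffunE|left].
by rewrite Bv Bpl Bi Bj /plane_vec !single0 !addr0.
Qed.
End Plane.

Lemma refl_rel i j k : m i j = Some k ->
  forall v, iter k (refl i \o refl j) v = v.
Proof.
move=> mij v; have [eij|nij] := eqVneq i j.
  case: mP => _ mii _; move: mij; rewrite eij mii => -[<-].
  exact: refl_invol.
case: k mij => // k mij; exact: rotation_order.
Qed.

Notation A := (cact refl).

Let relA := refl_rel.

Lemma cactD (w : coxeter_group m) v v' : A w (v + v') = A w v + A w v'.
Proof.
have [l ->] := prodw_surj mP w; rewrite !(cact_prodw mP relA).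
by elim: l => //= i l ->; rewrite reflD.
Qed.

Lemma cact0 (w : coxeter_group m) : A w 0 = 0.
Proof. by apply: (addrI (A w 0)); rewrite -cactD !addr0. Qed.

Lemma cactN (w : coxeter_group m) v : A w (- v) = - A w v.
Proof. by apply/eqP; rewrite -addr_eq0 -cactD addNr cact0. Qed.

Lemma cact_mulgen (w : coxeter_group m) i a :
  A (w * gen m i)%g (single i a) = - A w (single i a).
Proof. by rewrite (cactM mP relA) (cact_gen mP relA) refl_single cactN. Qed.

Lemma cheb_ext (f g : {additive M -> M}) b a k : f =1 g ->
  cheb f b a k = cheb g b a k.
Proof. by move=> fg; elim: k b a => // k IH b a; rewrite !chebS IH fg. Qed.

(** Each letter of an alternating word replaces the older of the two
    coefficients by the next term of the recursion. *)
Lemma cact_alt i j k a b : i != j -> exists i' j',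
  [/\ A (alt m i j k) (plane_vec i j a b) =
      plane_vec i' j' (cheb (N i j) b a k.+1) (cheb (N i j) b a k),
     i' \in [:: i; j] & j' \in [:: i; j]].
Proof.
elim: k i j a b => [|k IH] i j a b ij.
  by exists i, j; rewrite !inE !eqxx orbT (cact1 mP relA).
have ji : j != i by rewrite eq_sym.
have [i' [j' [e i'P j'P]]] := IH j i (N j i a - b) a ji.
exists i', j'; split.
- rewrite /= (cactM mP relA) (cact_gen mP relA) refl_plane_vec // plane_vecC e.
  by rewrite -!(cheb_ext _ _ _ (Nsym ij)) -(Nsym ij).
- by move: i'P; rewrite !inE orbC.
- by move: j'P; rewrite !inE orbC.
Qed.

Variable pos : M -> Prop.
Hypothesis pos0 : pos 0.
Hypothesis posD : forall x y, pos x -> pos y -> pos (x + y).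
Hypothesis pos_anti : forall x, pos x -> pos (- x) -> x = 0.
Hypothesis cheb_pos : forall i j k x, i != j ->
  (forall p, m i j = Some p -> (k <= p)%N) -> pos x -> pos (cheb (N i j) 0 x k).

Definition posV v := forall i, pos (v i).

Lemma posV_anti v : posV v -> posV (- v) -> v = 0.
Proof.
by move=> p q; apply/ffunP => i; rewrite ffunE; apply: pos_anti => //;
  have := q i; rewrite ffunE.
Qed.

(** Tits' theorem, by induction on the length of w.  If j is a possible last
    letter of w, take a factorisation w = v * alt i j k with
    len v + k <= len w and k as large as possible.  By maximality neither i
    nor j shortens v, and k < m_ij because alt i j m_ij could be rewritten to
    end in i.  The alternating word sends the root i to a combination of i and
    j whose coefficients are the terms k + 1 and k of the recursion, hence
    nonnegative, and induction applies to v. *)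
Lemma tits_pos (w : coxeter_group m) i x :
  (len mP w <= len mP (w * gen m i))%N -> pos x -> posV (A w (single i x)).
Proof.
have [L] := ubnP (len mP w); elim: L w i x => // L IH w i x wL wi px.
have [->|/eqP w1] := eqVneq w 1%g.
  by rewrite (cact1 mP relA) => l; rewrite ffunE; case: ifP.
have [j wj] := len_descent mP w1.
have ij : i != j by apply: contraTneq wi => ->; rewrite -ltnNge.
pose P k := `[< exists2 v : coxeter_group m, w = (v * alt m i j k)%g
  & (len mP v + k <= len mP w)%N >].
have P1 : P 1%N.
  apply/asboolP; exists (w * gen m j)%g; rewrite /= ?mul1g ?mulgenK //.
  by rewrite addn1.
have Pb k : P k -> (k <= len mP w)%N.
  by move=> /asboolP [v _]; apply: leq_trans; apply: leq_addl.
case: (ex_maxnP (ex_intro P 1%N P1) Pb) => k /asboolP [v wE vk] kmax.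
have k1 := kmax _ P1.
(* The next letter on the left is ruled out by the maximality of k. *)
have v_next : (len mP v <= len mP (v * gen m (if odd k then i else j)))%N.
  rewrite leqNgt; apply/negP => vlt.
  suff /kmax : P k.+1 by rewrite ltnn.
  apply/asboolP; exists (v * gen m (if odd k then i else j))%g.
    by rewrite alt_left mulgA mulgenK.
  by rewrite addnS (leq_trans _ vk) // ltn_add2r.
(* The leftmost letter of the alternating word is ruled out by the length. *)
have v_last : (len mP v <= len mP (v * gen m (if odd k then j else i)))%N.
  case: k k1 wE vk {kmax v_next} => // k _ wE vk.
  have := lenM mP (v * gen m (if odd k then i else j))%g (alt m i j k).
  rewrite -mulgA -alt_left -wE => /(leq_trans vk).
  have := alt_len mP i j k; rewrite /=; case: (odd k) => /=; lia.
have vij t : t \in [:: i; j] -> (len mP v <= len mP (v * gen m t))%N.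
  by rewrite !inE => /orP [] /eqP ->; move: v_next v_last; case: (odd k).
have km p : m i j = Some p -> (k < p)%N.
  move=> mij; rewrite ltnNge; apply/negP => pk.
  have [i' [j' e]] := alt_split m i j (k - p) p; rewrite subnK // in e.
  have := lenM mP (v * alt m i' j' (k - p)%N)%g (alt m j i p.+1).
  rewrite /= mulgA -(mulgA v) -e -wE leqNgt => /negP; apply.
  have mji : m j i = Some p by case: mP => ms _ _; rewrite ms.
  have := alt_succ_len mP mji; have := lenM mP v (alt m i' j' (k - p)).
  have p2 : (2 <= p)%N by case: mP => _ _ /(_ i j p ij mij).
  have := alt_len mP i' j' (k - p); rewrite /=; move: wi vk.
  move: (len mP (w * gen m i)) (len mP (alt m i j p * gen m i)).
  move: (len mP (v * alt m i' j' (k - p))) (len mP (alt m i' j' (k - p))).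
  move=> ? ? ? ?; lia.
have vL : (len mP v < L)%N by lia.
have [i' [j' [e i'P j'P]]] := cact_alt k x 0 ij.
have -> : single i x = plane_vec i j x 0.
  by rewrite /plane_vec single0 addr0.
rewrite wE (cactM mP relA) e cactD => l; rewrite ffunE; apply: posD.
  by apply: IH => //; [exact: vij|apply: cheb_pos => // p /km].
by apply: IH => //; [exact: vij|apply: cheb_pos => // p /km /ltnW].
Qed.

Lemma tits_neg (w : coxeter_group m) i x :
  (len mP (w * gen m i) < len mP w)%N -> pos x -> posV (- A w (single i x)).
Proof.
move=> wi px; rewrite -cact_mulgen; apply: tits_pos => //.
by rewrite mulgenK // ltnW.
Qed.

Lemma cact_single_neq0 (w : coxeter_group m) i x :
  x <> 0 -> A w (single i x) <> 0.
Proof.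
move=> x0 /(congr1 (A w^-1%g)); rewrite (cactK mP relA) cact0 => /ffunP /(_ i).
by rewrite !ffunE eqxx.
Qed.

(** An element other than 1 has a descent, hence sends some simple root to a
    negative vector. *)
Lemma reflection_faithful x0 (w : coxeter_group m) : pos x0 -> x0 <> 0 ->
  (forall v, A w v = v) -> w = 1%g.
Proof.
move=> px x0N wv; apply: contrapT => w1; have [i wi] := len_descent mP w1.
apply: (@cact_single_neq0 1%g i x0) => //; rewrite (cact1 mP relA).
apply: posV_anti; first by move=> l; rewrite ffunE; case: ifP.
by have := tits_neg wi px; rewrite wv.
Qed.

End Reflections.

(** * Integral coefficients: adjacency operators of paths *)

(** On a path with p vertices the k-th term of the recursion has entries 0 and
    1: they are the truncated Clebsch-Gordan coefficients of SU(2).  This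
    makes the nonnegativity before the index p + 1, and the vanishing there,
    visible. *)

Section Paths.
Local Open Scope ring_scope.

(** For spins (k - 1) / 2, a / 2, c / 2: the triangle inequalities, the
    truncation at level p - 1 and the parity condition. *)
Definition fusion (p k a c : nat) : bool :=
  [&& k <= (a + c).+1, a < k + c, c < k + a, k + a + c < p.*2 &
      odd (k + a + c)]%N.

Lemma fusion_rec p k a c : (k < p)%N -> (a < p)%N -> (c < p)%N ->
  ((0 < a) && fusion p k.+1 a.-1 c + (a.+1 < p) && fusion p k.+1 a.+1 c
   = fusion p k.+2 a c + fusion p k a c)%N.
Proof.
case: a => [|a] kp ap cp; rewrite /fusion /=; last first.
  rewrite !addSn !addnS !addSn /= !negbK.
  by case o: (odd (k + a + c)); rewrite ?andbF //= !andbT; lia.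
rewrite !addnS !addSn !addn0 !add0n /= !negbK.
by case o: (odd (k + c)); rewrite ?andbF //= !andbT; lia.
Qed.

Section PathOperator.
Variables (R : zmodType) (L : nat).
Let M := {ffun 'I_L.+1 -> R}.

(** The vertices 0, ..., L are cut into consecutive paths of p vertices; the
    tests on a %% p keep the two neighbours in the path of a.  In the case of
    an infinite entry the operator is multiplication by 2, the limit value of
    2 cos(pi / m). *)
Definition path_op (o : option nat) (f : M) : M :=
  if o is Some p then
    [ffun a : 'I_L.+1 => (if (0 < a %% p)%N then f (inord a.-1) else 0) +
                         (if ((a %% p).+1 < p)%N then f (inord a.+1) else 0)]
  else f + f.

Lemma path_op_is_additive o : zmod_morphism (path_op o).
Proof.
case: o => [p|] f g /=; last by rewrite opprD addrACA.
apply/ffunP => a; rewrite !ffunE opprD addrACA.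
by congr (_ + _); case: ifP => _; rewrite ?subr0 ?oppr0 ?addr0.
Qed.

HB.instance Definition _ o :=
  GRing.isZmodMorphism.Build M M (path_op o) (path_op_is_additive o).

Lemma cheb_path_inf f k : cheb (path_op None) 0 f k = f *+ k.
Proof.
(* The recursion is of order two, so two consecutive terms are tracked. *)
suff: cheb (path_op None) 0 f k = f *+ k /\
    cheb (path_op None) 0 f k.+1 = f *+ k.+1.
  by case.
elim: k => [|k [IH1 IH2]]; first by split.
split=> //; rewrite chebSS IH1 IH2 /=; apply/eqP.
by rewrite subr_eq -!mulrnDr; apply/eqP; congr (_ *+ _); lia.
Qed.

Variable p : nat.
Hypotheses (p0 : (0 < p)%N) (pL : (p %| L.+1)%N).

Let E k (a c : 'I_L.+1) : bool :=
  ((a %/ p == c %/ p) && fusion p k (a %% p) (c %% p))%N.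

Lemma pred_block (a : 'I_L.+1) : (0 < a %% p)%N ->
  ((inord a.-1 : 'I_L.+1) %/ p = a %/ p /\
   (inord a.-1 : 'I_L.+1) %% p = (a %% p).-1)%N.
Proof.
move=> a0; rewrite inordK; last by have := ltn_ord a; lia.
have ap := ltn_pmod a p0.
have e : (a.-1 = a %/ p * p + (a %% p).-1)%N.
  by rewrite {1}(divn_eq a p) -!subn1 addnBA.
have lt : ((a %% p).-1 < p)%N by rewrite (leq_ltn_trans (leq_pred _)).
by split; rewrite e ?divnMDl // ?modnMDl
  ?(divn_small lt) ?(modn_small lt) ?addn0.
Qed.

Lemma succ_block (a : 'I_L.+1) : ((a %% p).+1 < p)%N ->
  ((inord a.+1 : 'I_L.+1) %/ p = a %/ p /\
   (inord a.+1 : 'I_L.+1) %% p = (a %% p).+1)%N.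
Proof.
move=> ap.
have e : (a.+1 = a %/ p * p + (a %% p).+1)%N
  by rewrite {1}(divn_eq a p) addnS.
have aL : (a.+1 < L.+1)%N.
  rewrite ltn_neqAle ltn_ord andbT; apply: contraTneq pL => <-.
  by rewrite e dvdn_addr ?dvdn_mull // gtnNdvd.
by split; rewrite inordK // e ?divnMDl // ?modnMDl
  ?(divn_small ap) ?(modn_small ap) ?addn0.
Qed.

Lemma cheb_path f k a : (k <= p.+1)%N ->
  cheb (path_op (Some p)) 0 f k a = \sum_(c | E k a c) f c.
Proof.
suff H l : (l <= p)%N ->
    (forall a, cheb (path_op (Some p)) 0 f l a = \sum_(c | E l a c) f c) /\
    (forall a, cheb (path_op (Some p)) 0 f l.+1 a = \sum_(c | E l.+1 a c) f c).
  case: k => [_|k kp]; [by case: (H 0%N)|by case: (H k)].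
elim: l => [|l IH] lp.
  split=> b.
    by rewrite big_pred0 ?ffunE // => c; rewrite /E /fusion; lia.
  rewrite (big_pred1 b) // => c; rewrite /E /fusion /=.
  have bp := ltn_pmod b p0; have cp := ltn_pmod c p0.
  apply/idP/eqP => [|->]; last by rewrite eqxx /=; lia.
  case/andP => /eqP bc H; apply/val_inj => /=.
  rewrite (divn_eq b p) (divn_eq c p) bc; lia.
have [IH1 IH2] := IH (ltnW lp); split=> // b.
rewrite chebSS !ffunE IH1 (IH2 (inord b.-1)) (IH2 (inord b.+1)).
apply/eqP; rewrite subr_eq; apply/eqP.
have sumE (P : pred 'I_L.+1) : \sum_(c | P c) f c = \sum_c f c *+ P c.
  by rewrite big_mkcond /=; apply: eq_bigr => c _; case: (P c).
have ifE t (P : pred 'I_L.+1) : (if t then \sum_(c | P c) f c else 0)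
    = \sum_c f c *+ (t && P c).
  by case: t; rewrite ?sumE //= big1.
rewrite !ifE !sumE -!big_split /=; apply: eq_bigr => c _; rewrite -!mulrnDr.
congr (_ *+ _).
have := fusion_rec lp (ltn_pmod b p0) (ltn_pmod c p0).
rewrite /E; have [b1|b1] := boolP (0 < b %% p)%N;
  have [b2|b2] := boolP ((b %% p).+1 < p)%N; rewrite ?andbF //=;
  rewrite ?(proj1 (pred_block b1)) ?(proj2 (pred_block b1))
    ?(proj1 (succ_block b2)) ?(proj2 (succ_block b2));
  by case: (_ == _).
Qed.
End PathOperator.
End Paths.

(** * Residual finiteness *)

Section Integral.
Local Open Scope ring_scope.
Variables (n : nat) (m : 'I_n -> 'I_n -> option nat).
Hypothesis mP : coxeter_matrix m.

(** L + 1 vertices can be cut into paths of m i j - 1 vertices for every pair at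
    once.  The default value for infinite entries only has to be at least 2. *)
Let block i j := (odflt 2 (m i j)).-1.
Let L := (\prod_(ij : 'I_n * 'I_n | ij.1 != ij.2) block ij.1 ij.2).-1.

Lemma block_gt0 i j : i != j -> (0 < block i j)%N.
Proof.
by case: mP => _ _ H ij; rewrite /block; case E: (m i j) => [k|] //=;
  have := H _ _ _ ij E; case: k {E} => [|[]].
Qed.

Lemma block_dvd i j : i != j -> (block i j %| L.+1)%N.
Proof.
move=> ij; rewrite prednK; last first.
  by apply: prodn_cond_gt0 => -[k l]; apply: block_gt0.
by rewrite (bigD1 (i, j)) //= dvdn_mulr.
Qed.

Section Coefficients.
Variable R : zmodType.
Let M := {ffun 'I_L.+1 -> R}.
(** Any coefficient group R is allowed, so that the same operators act on
    integral vectors and on vectors modulo q. *)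
Definition path_coef (i j : 'I_n) : {additive M -> M} :=
  path_op (omap predn (m i j)).
End Coefficients.

Let M := {ffun 'I_L.+1 -> int}.
Notation N := (path_coef int).

Lemma path_sym (i j : 'I_n) : i != j -> N i j =1 N j i.
Proof. by case: mP => ms _ _ _ x; rewrite /= ms. Qed.

Lemma path_tor2 (x : M) : x *+ 2 = 0 -> x = 0.
Proof.
by move=> /ffunP x0; apply/ffunP => a; have := x0 a;
  rewrite ffunMnE !ffunE => /eqP; rewrite mulrn_eq0 => /eqP.
Qed.

Lemma path_cheb_m i j k : i != j -> m i j = Some k ->
  forall x : M, cheb (N i j) 0 x k = 0.
Proof.
move=> ij mij x; have := block_gt0 ij; have := block_dvd ij.
rewrite /block mij /= => pL p0; have kp : k = k.-1.+1 by lia.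
rewrite /N mij; apply/ffunP => a; rewrite ffunE [in LHS]kp cheb_path //=.
by rewrite big_pred0 // => c; rewrite /fusion; lia.
Qed.

Definition ffun_nonneg (x : M) : Prop := forall a, 0 <= x a.

Lemma path_cheb_pos i j k x : i != j ->
  (forall p, m i j = Some p -> (k <= p)%N) -> ffun_nonneg x ->
  ffun_nonneg (cheb (N i j) 0 x k).
Proof.
move=> ij kp px a; have := block_gt0 ij; have := block_dvd ij.
rewrite /N /block; case mij: (m i j) => [q|] /= pL p0.
  by rewrite cheb_path //; [exact: sumr_ge0|have := kp _ mij; lia].
by rewrite cheb_path_inf ffunMnE mulrn_wge0.
Qed.

Lemma integral_faithful (w : coxeter_group m) :
  (forall v, cact (refl N) w v = v) -> w = 1%g.
Proof.
apply: (@reflection_faithful _ _ mP _ _ path_sym path_tor2 path_cheb_m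
  ffun_nonneg _ _ _ _ [ffun=> 1]).
- by move=> a; rewrite ffunE.
- by move=> x y px py a; rewrite ffunE addr_ge0.
- move=> x px nx; apply/ffunP => a; apply/eqP; rewrite ffunE eq_le px andbT.
  by have := nx a; rewrite ffunE oppr_ge0.
- by move=> *; apply: path_cheb_pos.
- by move=> a; rewrite ffunE.
by move=> /ffunP /(_ ord0); rewrite !ffunE.
Qed.

(** ** Reduction modulo q *)
Section Reduction.
Variable q : nat.

Definition reduce_mod (v : {ffun 'I_n -> M}) :
    {ffun 'I_n -> {ffun 'I_L.+1 -> 'Z_q}} :=
  [ffun i => [ffun a => (v i a)%:~R]].

Lemma reduce_mod_refl i v :
  reduce_mod (refl N i v) = refl (path_coef 'Z_q) i (reduce_mod v).
Proof.
apply/ffunP => j; rewrite !ffunE; case: ifP => _; last first.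
  by apply/ffunP => a; rewrite !ffunE.
apply/ffunP => a; rewrite !ffunE /=.
rewrite !sum_ffunE !rmorphD !rmorphN rmorph_sum /=.
congr (_ + _); apply: eq_bigr => l _; rewrite ffunE /path_coef /=.
case: (m i l) => [p|] /=; rewrite !ffunE rmorphD //=.
by congr (_ + _); case: ifP => _; rewrite ?ffunE.
Qed.

(** Surjectivity transfers the Coxeter relations from integral vectors, where
    their proof needs the absence of 2-torsion, to vectors modulo any q. *)
Lemma reduce_mod_surj u : exists v, reduce_mod v = u.
Proof.
exists [ffun i => [ffun a => (val (u i a))%:Z]].
by apply/ffunP => i; apply/ffunP => a; rewrite !ffunE -pmulrn natr_Zp.
Qed.

Lemma refl_rel_mod i j k : m i j = Some k -> forall u,
  iter k (refl (path_coef 'Z_q) i \o refl (path_coef 'Z_q) j) u = u.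
Proof.
move=> mij u; have [v <-] := reduce_mod_surj u.
rewrite -[in RHS](refl_rel mP path_sym path_tor2 path_cheb_m mij v).
by elim: k {mij} => //= k ->; rewrite !reduce_mod_refl.
Qed.

Lemma refl_mod_inj i : injective (refl (path_coef 'Z_q) i).
Proof. exact: inv_inj (refl_invol _ _). Qed.

Definition refl_mod_perm i : {perm {ffun 'I_n -> {ffun 'I_L.+1 -> 'Z_q}}} :=
  perm (@refl_mod_inj i).

(** The inverse appears because permutations compose from left to right. *)
Lemma congruence_hom : exists f : group_hom (coxeter_group m)
    {perm {ffun 'I_n -> {ffun 'I_L.+1 -> 'Z_q}}},
  forall w v, f w (reduce_mod v) = reduce_mod (cact (refl N) w^-1%g v).
Proof.
have [|f fg] := @coxeter_lift _ _ mP _ refl_mod_perm.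
  move=> i j k mij; apply/permP => u; rewrite perm1.
  have mji : m j i = Some k by case: mP => ms _ _; rewrite ms.
  rewrite -[RHS](refl_rel_mod mji).
  elim: k {mij mji} => [|k IH]; first by rewrite perm1.
  by rewrite expgSr !permM IH !permE.
have relA := refl_rel mP path_sym path_tor2 path_cheb_m.
exists f => w; have [l ->] := prodw_surj mP w.
elim: l => [|i l IH] v; first by rewrite gmulf1 perm1 invg1 cact1.
rewrite /= gmulfM permM fg permE -reduce_mod_refl IH invgM gen_inv // cactM //.
by rewrite cact_gen.
Qed.
End Reduction.

(** Some coordinate of some integral vector is changed by the inverse of w, and
    the change d survives modulo |d| + 2, which exceeds both |d| and 1. *)
Theorem residually_finite (w : coxeter_group m) : w <> 1%g ->
  exists (F : finGroupType) (f : group_hom (coxeter_group m) F), f w <> 1%g.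
Proof.
move=> w1; have [v wv] : exists v, cact (refl N) w^-1%g v <> v.
  apply: contrapT => H; apply: w1; apply/invg_inj; rewrite invg1.
  by apply: integral_faithful => v; apply: contrapT => ?; apply: H; exists v.
have [i [a wia]] : exists i a, cact (refl N) w^-1%g v i a <> v i a.
  apply: contrapT => H; apply: wv; apply/ffunP => i; apply/ffunP => a.
  by apply: contrapT => ?; apply: H; exists i, a.
pose d := cact (refl N) w^-1%g v i a - v i a.
have [f fE] := congruence_hom `|d|.+2; exists _, f => fw.
have := fE w v; rewrite fw perm1 => /ffunP /(_ i) /ffunP /(_ a).
rewrite !ffunE => /eqP; rewrite eq_sym -subr_eq0 -rmorphB -/d.
have d0 : (0 < `|d|)%N by rewrite absz_gt0 subr_eq0; apply/eqP.
have -> : (d%:~R == 0 :> 'Z_(`|d|.+2)) = (`|d|%:R == 0 :> 'Z_(`|d|.+2)).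
  by case: (intP d) => [|k|k]; rewrite ?rmorphN ?oppr_eq0 ?abszN -?pmulrn.
move/eqP/(congr1 val); rewrite /= val_Zp_nat // modn_small //= => e.
by rewrite e in d0.
Qed.

End Integral.

(** * The geometric representation and elements of finite order *)

Section Geometric.
Local Open Scope ring_scope.
Variables (R : realType) (n : nat) (m : 'I_n -> 'I_n -> option nat).
Hypothesis mP : coxeter_matrix m.

Definition cos_coef (i j : 'I_n) : R :=
  if m i j is Some k then 2 * cos (pi / k%:R) else 2.

Definition scalar (c x : R) : R := c * x.

Lemma scalar_is_additive c : zmod_morphism (scalar c).
Proof. by move=> x y; rewrite /scalar mulrBr. Qed.

HB.instance Definition _ c :=
  GRing.isZmodMorphism.Build R R (scalar c) (scalar_is_additive c).

Definition cos_op (i j : 'I_n) : {additive R -> R} := scalar (cos_coef i j).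
Notation N := cos_op.

Lemma cheb_sin (t x : R) k :
  cheb (scalar (2 * cos t)) 0 x k * sin t = sin (k%:R * t) * x.
Proof.
suff [] : cheb (scalar (2 * cos t)) 0 x k * sin t
      = sin (k%:R * t) * x /\
    cheb (scalar (2 * cos t)) 0 x k.+1 * sin t
      = sin (k.+1%:R * t) * x by [].
elim: k => [|k [IH1 IH2]].
  split; first by rewrite mul0r mulr0n mul0r sin0 mul0r.
  by rewrite mul1r mulrC.
split=> //; rewrite chebSS mulrBl IH1 /scalar -mulrA IH2.
have -> : k%:R * t = k.+1%:R * t - t by rewrite -natr1; ring.
have -> : k.+2%:R * t = k.+1%:R * t + t by rewrite -[k.+2%:R]natr1; ring.
rewrite sinB sinD; ring.
Qed.

Lemma sin_pi_div_gt0 (k : nat) : (2 <= k)%N -> 0 < sin (pi / k%:R : R).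
Proof.
move=> k2; have p0 := pi_gt0 R.
apply: sin_gt0_pi; rewrite divr_gt0 ?ltr0n ?(ltnW k2) //=.
rewrite ltr_pdivrMr ?ltr0n ?(ltnW k2) // -[ltLHS]mulr1 ltr_pM2l //.
by rewrite ltr1n.
Qed.

Lemma cos_sym (i j : 'I_n) : i != j -> N i j =1 N j i.
Proof. by case: mP => ms _ _ _ x; rewrite /= /cos_coef ms. Qed.

Lemma real_tor2 (x : R) : x *+ 2 = 0 -> x = 0.
Proof. by move/eqP; rewrite mulrn_eq0 => /eqP. Qed.

Lemma coxeter_entry_ge2 i j k : i != j -> m i j = Some k -> (2 <= k)%N.
Proof. by case: mP => _ _ H; apply: H. Qed.

Lemma cos_cheb_m i j k : i != j -> m i j = Some k ->
  forall x : R, cheb (N i j) 0 x k = 0.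
Proof.
move=> ij mij x; have k2 := coxeter_entry_ge2 ij mij.
have s0 := sin_pi_div_gt0 k2.
apply: (mulIf (lt0r_neq0 s0)); rewrite /N /cos_coef mij cheb_sin mulrCA divff.
  by rewrite mulr1 sinpi !mul0r.
by rewrite pnatr_eq0; lia.
Qed.

Lemma cos_cheb_pos i j k (x : R) : i != j ->
  (forall p, m i j = Some p -> (k <= p)%N) -> 0 <= x -> 0 <= cheb (N i j) 0 x k.
Proof.
move=> ij kp x0; rewrite /N /cos_coef; case mij: (m i j) => [p|].
  have p2 := coxeter_entry_ge2 ij mij; have s0 := sin_pi_div_gt0 p2.
  rewrite -(pmulr_lge0 _ s0) cheb_sin mulr_ge0 //; apply: sin_ge0_pi.
  have pi0 := pi_gt0 R; have p0 : 0 < p%:R :> R by rewrite ltr0n; lia.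
  apply/andP; split; first by rewrite mulr_ge0 ?divr_ge0 // ltW.
  by rewrite mulrA ler_pdivrMr // mulrC ler_pM2l // ler_nat kp.
suff -> : cheb (scalar 2) 0 x k = k%:R * x by rewrite mulr_ge0.
suff [] : cheb (scalar 2) 0 x k = k%:R * x /\
  cheb (scalar 2) 0 x k.+1 = k.+1%:R * x by [].
elim: k {kp} => [|k [IH1 IH2]]; first by rewrite mul0r mul1r.
split=> //; rewrite chebSS IH1 IH2 /= /scalar.
by rewrite -[k.+2%:R]natr1 -[k.+1%:R]natr1; ring.
Qed.

Let W := coxeter_group m.
Let V := {ffun 'I_n -> R}.
Notation A := (cact (refl N)).
Notation alpha i := (single i (1 : R)).
Let nonneg (x : R) : Prop := 0 <= x.
Let posV : V -> Prop := posV nonneg.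

Let relA := refl_rel mP cos_sym real_tor2 cos_cheb_m.
Let AD (w : W) := cactD mP cos_sym real_tor2 cos_cheb_m w.

Lemma root_pos (w : W) i :
  (len mP w <= len mP (w * gen m i))%N -> posV (A w (alpha i)).
Proof.
move=> wi; apply: (@tits_pos _ _ mP _ _ cos_sym real_tor2 cos_cheb_m
  nonneg _ _ _ _ _ _ wi).
- exact: lexx.
- by move=> x y; apply: addr_ge0.
- by move=> *; apply: cos_cheb_pos.
exact: ler01.
Qed.

Lemma root_neg (w : W) i :
  (len mP (w * gen m i) < len mP w)%N -> posV (- A w (alpha i)).
Proof.
move=> wi; apply: (@tits_neg _ _ mP _ _ cos_sym real_tor2 cos_cheb_m
  nonneg _ _ _ _ _ _ wi).
- exact: lexx.
- by move=> x y; apply: addr_ge0.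
- by move=> *; apply: cos_cheb_pos.
exact: ler01.
Qed.

Lemma root_neq0 (w : W) i : A w (alpha i) <> 0.
Proof.
apply: (cact_single_neq0 mP cos_sym real_tor2 cos_cheb_m).
by apply/eqP; rewrite oner_eq0.
Qed.

Lemma posV0 (v : V) : posV v -> posV (- v) -> v = 0.
Proof.
apply: posV_anti => x; rewrite /nonneg oppr_ge0 => p q.
by apply/eqP; rewrite eq_le p q.
Qed.

(** Otherwise the root of i would be sent by w to a vector that is both
    nonnegative and nonpositive. *)
Lemma len_neq (w : W) i : len mP (w * gen m i) <> len mP w.
Proof.
move=> e; apply: (@root_neq0 w i); apply: posV0.
  by apply: root_pos; rewrite e.
rewrite -(cact_mulgen mP cos_sym real_tor2 cos_cheb_m).
by apply: root_pos; rewrite mulgenK // e.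
Qed.

Definition dilate (c : R) (v : V) : V := [ffun i => c * v i].

Lemma reflZ i c (v : V) : refl N i (dilate c v) = dilate c (refl N i v).
Proof.
apply/ffunP => j; rewrite !ffunE; case: ifP => // _.
rewrite mulrDr mulrN mulr_sumr; congr (_ + _).
by apply: eq_bigr => l _; rewrite ffunE /= /scalar mulrCA.
Qed.

Lemma cactZ (w : W) c (v : V) : A w (dilate c v) = dilate c (A w v).
Proof.
have [l ->] := prodw_surj mP w; rewrite !(cact_prodw mP relA).
by elim: l => //= i l ->; rewrite reflZ.
Qed.

Lemma singleE i (c : R) : single i c = dilate c (alpha i).
Proof.
by apply/ffunP => j; rewrite !ffunE; case: ifP; rewrite ?mulr1 ?mulr0.
Qed.

Definition height (v : V) : R := \sum_i v i.

Lemma height_gt0 (v : V) : posV v -> v <> 0 -> 0 < height v.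
Proof.
move=> vpos v0; rewrite lt_neqAle sumr_ge0 ?andbT; last first.
  by move=> i _; apply: vpos.
apply/eqP => e; apply: v0; apply/ffunP => i; rewrite ffunE.
move/esym/eqP: e; rewrite psumr_eq0; last by move=> j _; apply: vpos.
by move/allP/(_ i (mem_index_enum i))/eqP.
Qed.

(** ** Sums of translates of the height *)

(** The sum over the powers of an element of finite order is the invariant
    functional; its translates are again sums of this form, over other
    families gs. *)
Section Sums.
Variable gs : seq W.

Definition sum_height (v : V) : R := \sum_(g <- gs) height (A g v).

Lemma sum_heightD v v' : sum_height (v + v') = sum_height v + sum_height v'.
Proof.
rewrite -big_split; apply: eq_bigr => g _ /=; rewrite AD -big_split.
by apply: eq_bigr => i _; rewrite ffunE.
Qed.

Lemma sum_heightZ c v : sum_height (dilate c v) = c * sum_height v.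
Proof.
rewrite mulr_sumr; apply: eq_bigr => g _; rewrite cactZ mulr_sumr.
by apply: eq_bigr => i _; rewrite ffunE.
Qed.

Lemma sum_height0 : sum_height 0 = 0.
Proof. by apply: (addrI (sum_height 0)); rewrite -sum_heightD !addr0. Qed.

Lemma sum_heightN v : sum_height (- v) = - sum_height v.
Proof. by apply/eqP; rewrite -addr_eq0 -sum_heightD addNr sum_height0. Qed.

Lemma sum_height_sum (F : 'I_n -> V) :
  sum_height (\sum_i F i) = \sum_i sum_height (F i).
Proof. exact: (big_morph sum_height sum_heightD sum_height0). Qed.

Lemma sum_height_coord v : sum_height v = \sum_i v i * sum_height (alpha i).
Proof.
rewrite {1}(ffun_single v) sum_height_sum; apply: eq_bigr => i _.
by rewrite singleE sum_heightZ.
Qed.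

(** By Tits' theorem the summand of g is positive on the root A u (alpha i)
    unless the generator i shortens g * u. *)
Lemma sum_height_le0 u i : gs <> [::] -> sum_height (A u (alpha i)) <= 0 ->
  exists2 g, g \in gs & (len mP (g * u * gen m i) < len mP (g * u))%N.
Proof.
move=> gs0; rewrite leNgt => le0; apply: contrapT => H; case/negP: le0.
have pg g : g \in gs -> 0 < height (A g (A u (alpha i))).
  move=> ggs; rewrite -(cactM mP relA).
  apply: height_gt0; last exact: root_neq0.
  by apply: root_pos; rewrite leqNgt; apply/negP => lt; apply: H; exists g.
rewrite /sum_height; case: gs gs0 pg {H} => // g s _ pg; rewrite big_cons.
rewrite ltr_wpDr ?pg ?mem_head // big_seq sumr_ge0 // => h hs.
by rewrite ltW // pg // inE hs orbT.
Qed.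

(** Galleries from 1 to u that never turn back.  The sign condition is what
    the descent towards a dominant functional has in common with reduced words
    in its stabiliser, so that one estimate bounds the length of both. *)
Inductive chain : W -> nat -> Prop :=
| chain1 : chain 1%g 0
| chainS u t i of chain u t & sum_height (A u (alpha i)) <= 0
    & (len mP u < len mP (u * gen m i))%N : chain (u * gen m i)%g t.+1.

(** Each step lengthens u by one and shortens some g * u with g in gs, while the
    other g * u gain at most one.  So the sum over gs of len u - len (g * u)
    grows with every step, whereas it lies between - S and S, where S is the
    total length of gs. *)
Lemma chain_bound u t : gs <> [::] -> chain u t ->
  (t <= (\sum_(g <- gs) len mP g).*2)%N.
Proof.
move=> gs0 ut.
have H : (t + \sum_(g <- gs) len mP (g * u) <=
          \sum_(g <- gs) len mP g + \sum_(g <- gs) len mP u)%N.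
  elim: ut => [|{}u {}t i _ IH mui lui].
    rewrite add0n len1 big1_eq addn0; apply: leq_sum => g _.
    by rewrite mulg1.
  have [g ggs lg] := sum_height_le0 gs0 mui.
  have lui1 : len mP (u * gen m i) = (len mP u).+1.
    by apply/eqP; rewrite eqn_leq lui len_mulgen.
  have lt : (\sum_(g <- gs) len mP (g * (u * gen m i)) <
             \sum_(g <- gs) (len mP (g * u) + 1))%N.
    rewrite (big_rem g) //= [X in (_ < X)%N](big_rem g) //= -addSn.
    apply: leq_add; first by rewrite mulgA addn1 ltnS ltnW.
    by apply: leq_sum => h _; rewrite mulgA addn1 len_mulgen.
  rewrite lui1 -[(len mP u).+1]addn1 [X in (_ <= _ + X)%N]big_split /=.
  by move: lt IH; rewrite big_split /=; lia.
have H' : (\sum_(g <- gs) len mP u <=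
           \sum_(g <- gs) len mP g + \sum_(g <- gs) len mP (g * u))%N.
  rewrite -big_split /=; apply: leq_sum => g _.
  by rewrite -{1}[u](mulKg g) (leq_trans (lenM _ _ _)) // lenV.
move: H H'; lia.
Qed.

(** ** Descent to the fundamental chamber *)
Inductive descending : W -> nat -> Prop :=
| descending1 : descending 1%g 0
| descendingS u t i of descending u t & sum_height (A u (alpha i)) < 0 :
    descending (u * gen m i)%g t.+1.

(** A descending gallery crosses only walls on whose positive roots the
    functional is negative: the root A w (alpha j) can become negative under u
    only at a step where it is a multiple of the simple root being reflected,
    and at that step the sign of the functional is known. *)
Lemma descending_wall u t w j : descending u t ->
  posV (A w (alpha j)) -> posV (- A (u * w)%g (alpha j)) ->
  0 <= sum_height (A (u * w)%g (alpha j)).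
Proof.
move=> ut; elim: ut w => [|{}u {}t i _ IH mui] w.
  by rewrite mul1g => p /(posV0 p) /root_neq0.
rewrite -mulgA => pw nuw; have [le|lt] := leqP (len mP (gen m i * w)%g)
   (len mP (gen m i * w * gen m j)).
  by apply: IH => //; apply: root_pos.
have := root_neg lt; set v := A w (alpha j) in pw *.
have vE : A (gen m i * w)%g (alpha j) = refl N i v.
  by rewrite (cactM mP relA) (cact_gen mP relA).
rewrite vE => nv.
have -> : A (u * (gen m i * w))%g (alpha j) = dilate (- v i) (A u (alpha i)).
  rewrite (cactM mP relA) vE.
  have {1}-> : v = dilate (v i) (alpha i).
    rewrite -singleE; apply/ffunP => l; rewrite ffunE.
    case: eqP => [->//|/eqP li]; apply/eqP; rewrite eq_le.
    have := pw l; rewrite /nonneg => ->; rewrite andbT.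
    by have := nv l; rewrite /nonneg !ffunE (negPf li) oppr_ge0.
  rewrite reflZ refl_single -cactZ; congr (A u).
  by apply/ffunP => l; rewrite !ffunE mulrN mulNr.
rewrite sum_heightZ mulNr oppr_ge0; apply: mulr_ge0_le0; [exact: pw|exact: ltW].
Qed.

(** A root whose wall has already been crossed has been made positive for the
    functional, so the descent never turns back. *)
Lemma descending_len u t j : descending u t -> sum_height (A u (alpha j)) < 0 ->
  (len mP u < len mP (u * gen m j))%N.
Proof.
move=> ut muj; rewrite ltn_neqAle eq_sym; apply/andP; split.
  by apply/eqP; apply: len_neq.
rewrite leqNgt; apply/negP => lt; move: muj; apply/negP; rewrite -leNgt.
rewrite -[u]mulg1; apply: (descending_wall ut); rewrite ?mulg1.
  by rewrite (cact1 mP relA) => l; rewrite /nonneg ffunE; case: ifP.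
exact: root_neg.
Qed.

Lemma descending_chain u t : descending u t -> chain u t.
Proof.
elim=> [|{}u {}t i ut IH mui]; first exact: chain1.
by apply: chainS => //; [exact: ltW|exact: descending_len ut mui].
Qed.

Lemma dominant_translate : gs <> [::] ->
  exists u : W, forall j, 0 <= sum_height (A u (alpha j)).
Proof.
move=> gs0; apply: contrapT => H.
have [u ut] : exists u, descending u (\sum_(g <- gs) len mP g).*2.+1.
  elim: _.+1 => [|t [u ut]]; first by exists 1%g; constructor.
  have [j mj] : exists j, sum_height (A u (alpha j)) < 0.
    apply: contrapT => Hj; apply: H; exists u => j.
    by rewrite leNgt; apply/negP => ?; apply: Hj; exists j.
  by exists (u * gen m j)%g; constructor.
by have := chain_bound gs0 (descending_chain ut); rewrite ltnn.
Qed.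

(** ** The stabiliser of a dominant functional *)
Hypothesis dom : forall j, 0 <= sum_height (alpha j).

Definition wall (j : 'I_n) : bool := sum_height (alpha j) == 0.

Lemma sum_height_pos v : posV v -> 0 <= sum_height v.
Proof.
move=> vpos; rewrite sum_height_coord sumr_ge0 // => i _.
by rewrite mulr_ge0 ?vpos.
Qed.

Lemma sum_height_refl j v : wall j -> sum_height (refl N j v) = sum_height v.
Proof.
move=> /eqP fj; rewrite -[refl N j v](subrK v) sum_heightD sum_height_coord.
rewrite big1 ?add0r // => i _.
have [->|/negPf ij] := eqVneq i j; first by rewrite fj mulr0.
by rewrite !ffunE ij subrr mul0r.
Qed.

Lemma wall_invariant l v :
  all wall l -> sum_height (A (prodw m l) v) = sum_height v.
Proof.
rewrite (cact_prodw mP relA); elim: l => //= i l IH /andP [fi fl].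
by rewrite sum_height_refl ?IH.
Qed.

(** If j is a descent of w, then w sends the root of j to a negative vector, on
    which a dominant functional is at most 0; by invariance it vanishes on the
    root of j.  Removing such letters one by one yields a word that is also a
    chain, so its length is bounded. *)
Lemma stabiliser_word w : (forall v, sum_height (A w v) = sum_height v) ->
  exists l, [/\ all wall l, w = prodw m l & chain w (size l)].
Proof.
have [L] := ubnP (len mP w); elim: L w => // L IH w wL wmu.
have [->|/eqP w1] := eqVneq w 1%g.
  by exists [::]; split=> //; constructor.
have [j wj] := len_descent mP w1.
have fj : wall j.
  rewrite /wall eq_le dom andbT -wmu -oppr_ge0 -sum_heightN.
  exact: sum_height_pos (root_neg wj).
have [|v|l [fl wl cl]] := IH (w * gen m j)%g; first exact: leq_trans wj _.
  by rewrite (cactM mP relA) wmu (cact_gen mP relA) sum_height_refl.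
exists (rcons l j); rewrite all_rcons fj fl prodw_rcons -wl mulgenK //.
split=> //.
rewrite -{1}[w](mulgenK mP j w) size_rcons; apply: chainS => //.
  by rewrite (cactM mP relA) wmu (cact_gen mP relA) sum_height_refl // (eqP fj).
by rewrite mulgenK.
Qed.

End Sums.

(** The bound B on the length of words expresses that the parabolic subgroup
    of J is finite. *)
Theorem finite_order_parabolic (x : W) k : (0 < k)%N -> (x ^+ k = 1)%g ->
  exists (u : W) (J : pred 'I_n) (B : nat),
    (exists2 l, all J l & (x ^ u)%g = prodw m l) /\
    (forall l, all J l ->
     exists2 l', (size l' <= B)%N & prodw m l = prodw m l').
Proof.
move=> k0 xk; pose gs := [seq (x ^+ i)%g | i <- iota 0 k].
have gs0 : gs <> [::] by rewrite /gs; case: k k0 {xk gs}.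
have mux v : sum_height gs (A x v) = sum_height gs v.
  pose F i := height (A (x ^+ i)%g v).
  have muF : sum_height gs v = \sum_(0 <= i < k) F i.
    by rewrite /sum_height big_map /index_iota subn0.
  have -> : sum_height gs (A x v) = \sum_(0 <= i < k) F i.+1.
    rewrite /sum_height big_map /index_iota subn0; apply: eq_bigr => i _.
    by rewrite /F -(cactM mP relA) -expgSr.
  have Fk : F k = F 0%N by rewrite /F xk expg0.
  rewrite muF; case: k k0 Fk {xk gs gs0 muF} => // k _ Fk.
  by rewrite big_nat_recr //= big_nat_recl //= Fk addrC.
have [u dom] := dominant_translate gs0.
pose gs' := [seq (g * u)%g | g <- gs].
have gs'0 : gs' <> [::] by rewrite /gs'; move: gs0; case: (gs).
have sumE v : sum_height gs' v = sum_height gs (A u v).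
  rewrite /sum_height big_map; apply: eq_bigr => g _.
  by rewrite (cactM mP relA).
have dom' j : 0 <= sum_height gs' (alpha j) by rewrite sumE.
have inv v : sum_height gs' (A (x ^ u)%g v) = sum_height gs' v.
  by rewrite !sumE -(cactM mP relA) conjgE mulVKg (cactM mP relA) mux.
exists u, (wall gs'), (\sum_(g <- gs') len mP g).*2; split.
  by have [l [fl e _]] := stabiliser_word dom' inv; exists l.
move=> l fl; have [|l' [fl' e cl]] := stabiliser_word (w := prodw m l) dom'.
  by move=> v; apply: wall_invariant.
by exists l' => //; apply: chain_bound cl.
Qed.

End Geometric.

(** * Conjugacy and separation *)

Definition conjugate (G : groupType) (a b : G) : Prop := exists g, b = a ^ g.

Section Conjugate.
Variable G : groupType.
Implicit Types a b c : G.

Lemma conjugate_sym a b : conjugate a b -> conjugate b a.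
Proof. by case=> g ->; exists g^-1; rewrite conjgK. Qed.

Lemma conjugate_trans b a c : conjugate a b -> conjugate b c -> conjugate a c.
Proof. by case=> g -> [h ->]; exists (g * h); rewrite conjgM. Qed.

Lemma conjugateJ a g : conjugate a (a ^ g).
Proof. by exists g. Qed.

Lemma conjugate_hom (H : groupType) (f : group_hom G H) a b :
  conjugate a b -> conjugate (f a) (f b).
Proof. by case=> g ->; exists (f g); rewrite gmulfJ. Qed.

(** A product of finitely many finite quotients detects finitely many nontrivial
    elements at once. *)
Lemma finite_separation (s : seq G) :
  (forall a, a <> 1 ->
   exists (F : finGroupType) (f : group_hom G F), f a <> 1) ->
  exists (F : finGroupType) (f : group_hom G F),
    forall a, a \in s -> f a = 1 -> a = 1.
Proof.
move=> rf; elim: s => [|a s [F [f fs]]].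
  have tM : {morph (fun _ : G => 1 : {perm 'I_1}) : x y / x * y}.
    by move=> x y; rewrite mulg1.
  by exists {perm 'I_1}, (Defs.Hom tM).
have [->|/eqP a1] := eqVneq a 1.
  exists F, f => b; rewrite inE => /predU1P [->//|]; exact: fs.
have [F' [f' f'a]] := rf _ a1.
have hM : {morph (fun x => (f x, f' x)) : x y / x * y}.
  by move=> x y; rewrite !gmulfM.
exists (F * F')%type, (Defs.Hom hM) => b.
rewrite inE => /predU1P [->|bs] [e e']; first by [].
exact: fs.
Qed.
End Conjugate.

Lemma short_words (T : finType) B :
  exists s : seq (seq T), forall l, (size l <= B)%N -> l \in s.
Proof.
elim: B => [|B [s sP]].
  by exists [:: [::]] => l; rewrite leqn0 size_eq0 inE.
exists ([::] :: [seq i :: l | i <- enum T, l <- s]) => -[|i l] // lB.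
by rewrite inE allpairs_f ?orbT ?mem_enum //; apply: sP.
Qed.

(** * Even Coxeter groups *)

Section Even.
Variables (n : nat) (m : 'I_n -> 'I_n -> option nat).
Hypotheses (mP : coxeter_matrix m) (me : even_matrix m).
Let W := coxeter_group m.

(** If one of s_i and s_j is sent to 1, the relator becomes the m_ij-th power of
    an involution, which is trivial because m_ij is even. *)
Lemma retraction (J : pred 'I_n) :
  exists f : group_hom W W, forall l, f (prodw m l) = prodw m (seq.filter J l).
Proof.
have [|f fg] := @coxeter_lift _ _ mP W (fun i => if J i then gen m i else 1).
  move=> i j k mij; have [eij|nij] := eqVneq i j.
    case: mP => _ mii _; move: mij; rewrite eij mii => -[<-].
    by rewrite expg1; case: (J j); rewrite ?mulg1 ?gen_sq.
  have gk t : gen m t ^+ k = 1.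
    have := me nij mij; rewrite -dvdn2 => /dvdnP [h ->].
    by rewrite mulnC expgnA expg2 gen_sq // expg1n.
  by case: (J i); case: (J j); rewrite ?mulg1 ?mul1g ?gk ?expg1n // gen_relator.
exists f; elim=> [|i l IH]; first exact: gmulf1.
by rewrite /= gmulfM fg IH; case: (J i); rewrite ?mul1g.
Qed.

Section Separation.
Variables x y : W.
Hypothesis inseparable : forall (F : finGroupType) (f : group_hom W F),
  exists g, f (x ^ g) = f y.

(** The image of f is a finite set, so some finite quotient is injective on it;
    composed with f, it separates the images of x and y unless they are
    conjugate. *)
Lemma conjugate_short_image (f : group_hom W W) B :
  (forall w, exists2 l, (size l <= B)%N & f w = prodw m l) ->
  conjugate (f x) (f y).
Proof.
move=> fB; have [s sP] := short_words 'I_n B.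
have [F [h hs]] := finite_separation (map (prodw m) s) (residually_finite mP).
have hfM : {morph (fun w => h (f w)) : a b / a * b}.
  by move=> a b; rewrite !gmulfM.
have [g /= e] := inseparable (Defs.Hom hfM).
exists (f g); rewrite -gmulfJ; apply/esym/eqP; rewrite -divg_eq1 -gmulfF.
apply/eqP/hs; last by rewrite !gmulfF e mulgV.
by have [l lB ->] := fB (x ^ g * y^-1); apply: map_f; apply: sP.
Qed.

Lemma inseparable_finite_order k : x ^+ k = 1 -> y ^+ k = 1.
Proof.
move=> xk; apply: contrapT => yk; have [F [f fy]] := residually_finite mP yk.
have [g e] := inseparable f; apply: fy.
by rewrite gmulfXn -e -gmulfXn -conjXg xk conj1g gmulf1.
Qed.

Lemma inseparable_conjugate : finite_order x -> conjugate x y.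
Proof.
case=> k k0 xk; have yk := inseparable_finite_order xk.
have parabolic := @finite_order_parabolic Rdefinitions.R _ _ mP.
have [u [I [B [[lx lxI xu] fI]]]] := parabolic _ _ k0 xk.
have [v [J [C [[ly lyJ yv] fJ]]]] := parabolic _ _ k0 yk.
have [rI rIE] := retraction I; have [rJ rJE] := retraction J.
have shortI : conjugate (rI x) (rI y).
  apply: (@conjugate_short_image _ B) => w; have [l ->] := prodw_surj mP w.
  by rewrite rIE; apply: fI; apply: filter_all.
have shortJ : conjugate (rJ x) (rJ y).
  apply: (@conjugate_short_image _ C) => w; have [l ->] := prodw_surj mP w.
  by rewrite rJE; apply: fJ; apply: filter_all.
have xx' := conjugateJ x u; have yy' := conjugateJ y v.
rewrite xu in xx'; rewrite yv in yy'.
have xI : conjugate x (rI (prodw m ly)).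
  apply: (conjugate_trans xx'); have /all_filterP e := lxI.
  rewrite -{1}e -rIE; apply: conjugate_trans (conjugate_hom rI yy').
  exact: conjugate_trans (conjugate_hom rI (conjugate_sym xx')) shortI.
have Jy : conjugate (rJ x) y.
  apply: conjugate_trans (conjugate_sym yy'); have /all_filterP e := lyJ.
  by rewrite -e -rJE; apply: conjugate_trans (conjugate_hom rJ yy').
have fixJ : rJ (rI (prodw m ly)) = rI (prodw m ly).
  by rewrite !rIE rJE -filter_predI -(eq_filter (fun i => andbC (I i) (J i)))
             filter_predI (all_filterP lyJ).
apply: (conjugate_trans xI); apply: conjugate_trans Jy; apply: conjugate_sym.
by rewrite -fixJ; apply: conjugate_hom.
Qed.
End Separation.
End Even.

Theorem proposition4p1 (W : groupType) (hW : even_coxeter_group W)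
    (x : W) (hx : finite_order x) :
  conjugacy_distinguished x.
Proof.
have [n [m [mP me [p [q pK qK]]]]] := hW.
rewrite /conjugacy_distinguished -openC profinite_openE => y nxy.
apply: contrapT => sep; apply: nxy.
have px : finite_order (p x).
  by have [k k0 xk] := hx; exists k; rewrite // -gmulfXn xk gmulf1.
have [|g e] := inseparable_conjugate mP me (x := p x) (y := p y) _ px.
  move=> F f; apply: contrapT => H; apply: sep.
  have fpM : {morph (fun w => f (p w)) : a b / a * b}.
    by move=> a b; rewrite !gmulfM.
  exists F, (Defs.Hom fpM) => z /= fz [g _ xg]; apply: H; exists (p g).
  by rewrite -gmulfJ [x ^ g]xg.
by exists (q g) => //; apply: (can_inj pK); rewrite gmulfJ qK.
Qed.
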